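(* Let $z_0\in\mathbb{C}$, let $k$ be a non-zero integer, and let $R>0$. If $h$ is a rational function such that $h(z_0)$ is finite and non-zero and $$\rho_h(z_0)\leq\dfrac{|k|}{(|k|+1)R},$$ then the function $(z-z_0)^kh(z)$ has no critical points in the punctured ball $\{z\in\mathbb{C}:0<|z-z_0|<R\}$.
   Context: Rational functions are elements of $\mathbb{C}(z)$, not identically zero. For a rational function $h$, let $Z_h$ and $P_h$ denote the sets of distinct finite zeros and distinct finite poles of $h$, respectively. For $w\in Z_h\cup P_h$, $\mathrm{mult}_h(w)$ denotes the multiplicity of $w$ as a zero or pole of $h$, taken positive if $w$ is a zero and negative if $w$ is a pole. For $z\in\mathbb{C}$, $$\rho_h(z)=\sum_{w\in Z_h\cup P_h,\ w\neq z}\left|\dfrac{\mathrm{mult}_h(w)}{z-w}\right|.$$ A critical point of a rational function $f$ is a point of $\mathbb{C}$ that is a zero of $f'$. *)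

(* Defs.v *)
(* The complex plane is R[i] for R : realType. *)
From mathcomp Require Import all_boot all_order all_algebra.
From mathcomp Require Import complex.
From mathcomp Require Import classical_sets fsbigop reals.

Set Implicit Arguments.
Unset Strict Implicit.
Unset Printing Implicit Defensive.

Import Order.TTheory GRing.Theory Num.Theory.
Local Open Scope classical_set_scope.
Local Open Scope ring_scope.

Notation "x %:F" := (@FracField.tofrac _ x) : ring_scope.

Section RationalFunctions.
Variable F : fieldType.
Implicit Types (h : {fraction {poly F}}) (w z : F).

(* The representative chosen by the quotient {fraction _} need not be in
   lowest terms, hence the division by the gcd. *)
Definition rf_num h : {poly F} := (repr h).1 %/ gcdp (repr h).1 (repr h).2.
Definition rf_den h : {poly F} := (repr h).2 %/ gcdp (repr h).1 (repr h).2.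

Lemma rf_den_neq0 h : rf_den h != 0.
Proof. by rewrite /rf_den dvdp_div_eq0 ?dvdp_gcdr // denom_ratioP. Qed.

Lemma rf_coprime h : coprimep (rf_num h) (rf_den h).
Proof. by rewrite /rf_num /rf_den coprimep_div_gcd // denom_ratioP orbT. Qed.

Lemma rf_numden h : h = (rf_num h)%:F / (rf_den h)%:F.
Proof.
have d0 : (repr h).2 != 0 := denom_ratioP (repr h).
have g0 : gcdp (repr h).1 (repr h).2 != 0 by rewrite gcdp_eq0 (negPf d0) andbF.
have eh : h = (repr h).1%:F / (repr h).2%:F.
  apply: (canRL (mulfK _)); first by rewrite tofrac_eq0.
  rewrite -{1}[h]reprK; set x := repr h in d0 *.
  rewrite /GRing.mul /=; apply/eqP; rewrite piE.
  by rewrite FracField.equivfE !numden_Ratio ?mulr1 ?oner_eq0 // mulrC.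
have en : (repr h).1 = rf_num h * gcdp (repr h).1 (repr h).2.
  by rewrite divpK ?dvdp_gcdl.
have ed : (repr h).2 = rf_den h * gcdp (repr h).1 (repr h).2.
  by rewrite divpK ?dvdp_gcdr.
move: g0 en ed eh; set g := gcdp _ _ => g0 -> -> {1}->.
by rewrite !tofracM invfM mulrACA divff ?mulr1 // tofrac_eq0.
Qed.

(* Zeros and poles are read off the reduced form, so they are disjoint, and every
   point is a zero of the zero function. *)
Definition rf_zeros h : set F := [set w | root (rf_num h) w].
Definition rf_poles h : set F := [set w | root (rf_den h) w].

(* Meaningful only when z is not a pole of h. *)
Definition rf_eval h z : F := (rf_num h).[z] / (rf_den h).[z].

(* By coprimality at most one of the two terms is nonzero. *)
Definition rf_mult h w : int := (mup w (rf_num h))%:Z - (mup w (rf_den h))%:Z.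

Definition rf_deriv h : {fraction {poly F}} :=
  ((rf_num h)^`() * rf_den h - rf_num h * (rf_den h)^`())%:F
    / (rf_den h ^+ 2)%:F.

Definition critical_point h z : Prop := rf_zeros (rf_deriv h) z.

End RationalFunctions.

(* \sum_(_ \in _) is the sum over a set on which the summand has finite
   support; for h != 0 the index set below is finite.  The value is a
   nonnegative real seen in R[i]: `|_| on R[i] takes its values in R[i]. *)
Definition rf_rho (R : realType) (h : {fraction {poly R[i]}}) (z : R[i]) : R[i] :=
  \sum_(w \in (rf_zeros h `|` rf_poles h) `\ z) `|(rf_mult h w)%:~R / (z - w)|.

(* Main.v *)
(* Write h = n/d in lowest terms.  Away from the zeros and poles of
   f = (z - z0)^k h, the point z is critical iff the logarithmic derivative
   k/(z - z0) + \sum_w mult_h(w)/(z - w) vanishes.  The bound on rho_h(z0)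
   bounds each of its terms, so every zero or pole w of h satisfies
   |z0 - w| >= (|k|+1)r/|k|; hence none lies in the ball, and
   |z0 - w| <= (|k|+1)|z - w| for z in the ball.  Therefore the sum has
   modulus at most (|k|+1) rho_h(z0) <= |k|/r < |k|/|z - z0|. *)
Require Import Defs.
From mathcomp Require Import all_boot all_order all_algebra.
From mathcomp Require Import complex.
From mathcomp Require Import classical_sets fsbigop reals.
From mathcomp Require Import ring.

Set Implicit Arguments.
Unset Strict Implicit.
Unset Printing Implicit Defensive.

Import Order.TTheory GRing.Theory Num.Theory.
Local Open Scope complex_scope.
Local Open Scope ring_scope.

Section LogarithmicDerivative.
Variable F : fieldType.
Implicit Types (p q : {poly F}) (z : F).

Definition logderiv p z : F := p^`().[z] / p.[z].

Lemma logderivM p q z : p.[z] != 0 -> q.[z] != 0 ->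
  logderiv (p * q) z = logderiv p z + logderiv q z.
Proof.
move=> p0 q0; rewrite /logderiv derivM hornerD !hornerM.
by field; rewrite p0 q0.
Qed.

Lemma logderivXsubC z0 z : logderiv ('X - z0%:P) z = (z - z0)^-1.
Proof. by rewrite /logderiv derivXsubC hornerC hornerXsubC div1r. Qed.

Lemma logderivX p z n : p.[z] != 0 ->
  logderiv (p ^+ n) z = logderiv p z *+ n.
Proof.
move=> p0; elim: n => [|n IH].
  by rewrite expr0 /logderiv derivC horner0 mul0r.
by rewrite exprS logderivM ?horner_exp ?expf_neq0 // IH mulrS.
Qed.

Lemma logderiv_scale_prod (c : F) (s : seq F) z : c != 0 -> z \notin s ->
  logderiv (c *: \prod_(w <- s) ('X - w%:P)) z = \sum_(w <- s) (z - w)^-1.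
Proof.
move=> c0 zs; rewrite -mul_polyC logderivM ?hornerC //; last first.
  by rewrite -/(root _ z) root_prod_XsubC.
rewrite {1}/logderiv derivC horner0 mul0r add0r.
elim: s zs => [|a s IH]; first by rewrite !big_nil /logderiv derivC horner0 mul0r.
rewrite inE negb_or => /andP[za zs]; rewrite !big_cons logderivM ?IH ?logderivXsubC //.
  by rewrite !hornerE subr_eq0.
by rewrite -/(root _ z) root_prod_XsubC.
Qed.

(** Groups repeated roots into multiplicities. The list [t] may exceed the support of [s]: extra
    points get count 0. *)
Lemma sum_count_mem (s t : seq F) (f : F -> F) : uniq t -> {subset s <= t} ->
  \sum_(w <- s) f w = \sum_(w <- t) (count_mem w s)%:R * f w.
Proof.
move=> ut; elim: s => [|a s IH] st.
  by rewrite big_nil big1 // => w _; rewrite mul0r.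
have at_ : a \in t by rewrite st ?mem_head.
have {}IH := IH (fun w ws => st w (mem_behead (s := a :: s) ws)).
rewrite big_cons IH; under [RHS]eq_bigr do rewrite /= natrD mulrDl.
rewrite big_split /=; congr (_ + _).
rewrite (bigD1_seq a) //= eqxx mul1r big1 ?addr0 // => w.
by rewrite eq_sym => /negPf ->; rewrite mul0r.
Qed.

End LogarithmicDerivative.

(** Over a closed field [p] splits into linear factors. Since [t] only has to contain the roots,
    numerator and denominator of [h] can share one list. *)
Lemma logderiv_mup (F : closedFieldType) (p : {poly F}) (t : seq F) (z : F) :
  uniq t -> (forall w, root p w -> w \in t) -> ~~ root p z ->
  logderiv p z = \sum_(w <- t) (mup w p)%:R / (z - w).
Proof.
move=> ut pt npz; have p0 : p != 0 by apply: contraNneq npz => ->; rewrite root0.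
have [s ps] := closed_field_poly_normal p.
have lc0 : lead_coef p != 0 by rewrite lead_coef_eq0.
have rs w : root p w = (w \in s) by rewrite ps rootZ // root_prod_XsubC.
rewrite [p in LHS]ps logderiv_scale_prod -?rs //.
rewrite (@sum_count_mem _ _ t) // => [|w]; last by rewrite -rs; apply: pt.
apply: eq_bigr => w _; congr (_%:R / _).
by rewrite ps -mul_polyC mupMr ?mu_prod_XsubC ?rootC.
Qed.

Section CriticalPoints.
Variable F : fieldType.
Implicit Types (h : {fraction {poly F}}) (p q : {poly F}) (z : F).

Lemma rf_coprime_root h z : root (rf_num h) z -> ~~ root (rf_den h) z.
Proof. exact: (coprimep_root (rf_coprime h)). Qed.

Lemma rf_num_den_cross h p q : q != 0 -> h = p%:F / q%:F ->
  rf_num h * q = p * rf_den h.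
Proof.
move=> q0; rewrite [h in h = _]rf_numden => /eqP.
by rewrite eqr_div ?tofrac_eq0 ?rf_den_neq0 // -!tofracM tofrac_eq => /eqP.
Qed.

(** Criticality is defined through the reduced form n/d, while [p / q] need not be reduced; the
    identity n q = p d carries the condition over. *)
Lemma critical_point_logderiv h p q z : h = p%:F / q%:F ->
  ~~ root p z -> ~~ root q z -> critical_point h z ->
  logderiv p z = logderiv q z.
Proof.
move=> hpq pz qz; rewrite /critical_point /rf_zeros /= => cz.
have q0 : q != 0 by apply: contraNneq qz => ->; rewrite root0.
have npd := rf_num_den_cross q0 hpq.
(* As q(z) is nonzero, a root of d at [z] would by n q = p d also be a root of n, against
   coprimality. *)
have dz : ~~ root (rf_den h) z.
  apply/negP => dz; have := rf_coprime_root (h := h) (z := z).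
  have : root (rf_num h * q) z by rewrite npd rootM dz orbT.
  by rewrite rootM (negPf qz) orbF => -> /(_ isT); rewrite dz.
have nz : ~~ root (rf_num h) z.
  apply/negP => nz; have : root (p * rf_den h) z by rewrite -npd rootM nz.
  by rewrite rootM (negPf pz) (negPf dz).
have d20 : rf_den h ^+ 2 != 0 by rewrite expf_neq0 ?rf_den_neq0.
(* [rf_deriv h] is itself put in lowest terms, so the zero of its reduced numerator has to be
   carried back to n' d - n d'. *)
have eqd := rf_num_den_cross d20 (erefl (rf_deriv h)).
have : root (rf_num (rf_deriv h) * rf_den h ^+ 2) z by rewrite rootM cz.
rewrite eqd rootM (negPf (rf_coprime_root cz)) orbF => wz.
have: logderiv (rf_num h * q) z = logderiv (p * rf_den h) z by rewrite npd.
rewrite !logderivM //.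
suff -> : logderiv (rf_num h) z = logderiv (rf_den h) z.
  by rewrite addrC => /addIr.
apply/eqP; rewrite /logderiv eqr_div // -subr_eq0; move: wz.
by rewrite /root !hornerE [_.[z] * (_^`()).[z]]mulrC.
Qed.

End CriticalPoints.

Lemma critical_point_XsubC_exp (F : fieldType) (h : {fraction {poly F}})
    (z0 z : F) (k : int) :
  z != z0 -> ~~ root (rf_num h) z -> ~~ root (rf_den h) z ->
  critical_point ((('X - z0%:P)%:F) ^ k * h) z ->
  k%:~R / (z - z0) + (logderiv (rf_num h) z - logderiv (rf_den h) z) = 0.
Proof.
move=> zz0 nz dz; set g := _ * h.
have Xz m : ~~ root (('X - z0%:P) ^+ m) z.
  by rewrite /root horner_exp expf_neq0 // !hornerE subr_eq0.
have X0 : ('X - z0%:P).[z] != 0 by rewrite !hornerE subr_eq0.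
(* The power joins the numerator when [k] is nonnegative; otherwise [k] is -(m+1) and the power
   [m.+1] joins the denominator. *)
case: k @g => m g.
  have gE : g = (('X - z0%:P) ^+ m * rf_num h)%:F / (rf_den h)%:F.
    by rewrite /g tofracM tofracXn -mulrA -rf_numden.
  move=> /(critical_point_logderiv gE); rewrite rootM negb_or Xz nz dz.
  move=> /(_ isT isT) <-; rewrite (logderivM (Xz m) nz) logderivX // logderivXsubC.
  by rewrite -mulr_natl pmulrn; ring.
have gE : g = (rf_num h)%:F / (('X - z0%:P) ^+ m.+1 * rf_den h)%:F.
  by rewrite /g tofracM tofracXn invfM mulrCA -rf_numden.
move=> /(critical_point_logderiv gE); rewrite rootM negb_or Xz nz dz.
move=> /(_ isT isT) ->; rewrite (logderivM (Xz m.+1) dz) logderivX // logderivXsubC.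
by rewrite NegzE mulrNz -mulr_natl -pmulrn; ring.
Qed.

Section WeightedPoints.
Variables (C : numFieldType) (t : seq C) (m : C -> int) (z0 z K r : C).
Hypotheses (K0 : 0 < K) (r0 : 0 < r) (z0t : z0 \notin t).
Hypothesis rho_le : \sum_(w <- t) `|(m w)%:~R / (z0 - w)| <= K / ((K + 1) * r).
Hypothesis zr : `|z - z0| < r.

Let K10 : 0 < K + 1. Proof. by rewrite addr_gt0. Qed.

(** A nonzero integer weight has modulus at least 1, so 1/|z0 - w| is at most one term of a sum of
    nonnegative terms, hence at most the bound. Here [K] stands for |k|. *)
Lemma weighted_point_far w : w \in t -> m w != 0 -> (K + 1) * r <= K * `|z0 - w|.
Proof.
move=> wt mw.
have zw : 0 < `|z0 - w|.
  by rewrite normr_gt0 subr_eq0; apply: contraNneq z0t => ->.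
have : `|z0 - w|^-1 <= K / ((K + 1) * r).
  apply: le_trans rho_le; rewrite (big_rem w) //=.
  apply: le_trans (_ : `|(m w)%:~R / (z0 - w)| <= _); last first.
    by rewrite lerDl sumr_ge0.
  rewrite normrM normfV ler_peMl ?invr_ge0 ?normr_ge0 //.
  by rewrite -intr_norm ler1z -gtz0_ge1 normr_gt0.
by rewrite ler_pdivlMr ?mulr_gt0 // mulrC ler_pdivrMr.
Qed.

(** Triangle inequality through [z0], times K + 1: the part (K + 1)|z - z0| is below (K + 1) r,
    hence below K |z0 - w|, which is then cancelled. *)
Lemma weighted_point_dist w : w \in t -> m w != 0 ->
  `|z0 - w| < (K + 1) * `|z - w|.
Proof.
move=> wt mw; have far := weighted_point_far wt mw.
have : (K + 1) * `|z0 - w| <= (K + 1) * `|z - z0| + (K + 1) * `|z - w|.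
  by rewrite -mulrDr ler_pM2l // [`|z - z0|]distrC ler_distD.
have : (K + 1) * `|z - z0| < K * `|z0 - w|.
  by apply: lt_le_trans far; rewrite ltr_pM2l.
move=> lt1 le2; have := le_lt_trans le2 (_ : _ < K * `|z0 - w| + (K + 1) * `|z - w|).
by rewrite ltrD2r => /(_ lt1); rewrite [X in X < _]mulrDl mul1r ltrD2l.
Qed.

Lemma weighted_point_neq w : w \in t -> m w != 0 -> z != w.
Proof.
move=> wt mw; have := weighted_point_dist wt mw.
by apply: contraTneq => ->; rewrite subrr normr0 mulr0 normr_lt0.
Qed.

Lemma weighted_sum_le : `|\sum_(w <- t) (m w)%:~R / (z - w)| <= K / r.
Proof.
apply: le_trans (ler_norm_sum _ _ _) _.
(* The factor K + 1 lost in replacing |z - w| by |z0 - w| is exactly the one in the assumed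
   bound. *)
have -> : K / r = (K + 1) * (K / ((K + 1) * r)).
  by field; rewrite !gt_eqF.
apply: le_trans (_ : (K + 1) * \sum_(w <- t) `|(m w)%:~R / (z0 - w)| <= _); last first.
  by rewrite ler_pM2l.
rewrite mulr_sumr big_seq [leRHS]big_seq; apply: ler_sum => w wt.
have [->|mw] := eqVneq (m w) 0; first by rewrite !mul0r normr0 mulr0.
have zw : 0 < `|z0 - w|.
  by rewrite normr_gt0 subr_eq0; apply: contraNneq z0t => ->.
have zw' : 0 < `|z - w| by rewrite normr_gt0 subr_eq0 weighted_point_neq.
rewrite !normrM !normfV mulrCA ler_wpM2l ?normr_ge0 //.
by rewrite ler_pdivlMr // mulrC ler_pdivrMr // ltW // weighted_point_dist.
Qed.

(** If the two terms cancelled, K/|z - z0| would be at most K/r, putting [z] outside the open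
    ball. *)
Lemma weighted_sum_neq0 (k : int) : z != z0 -> `|k|%:~R = K ->
  k%:~R / (z - z0) + \sum_(w <- t) (m w)%:~R / (z - w) != 0.
Proof.
move=> zz0 kK; apply/negP; rewrite addr_eq0 => /eqP e.
have := weighted_sum_le; rewrite -normrN -e normrM normfV -intr_norm kK.
rewrite ler_pM2l // lef_pV2 ?posrE ?normr_gt0 ?subr_eq0 //.
by move=> /(lt_le_trans zr); rewrite ltxx.
Qed.

End WeightedPoints.

Section ZerosAndPoles.
Variable C : closedFieldType.
Implicit Types (h : {fraction {poly C}}) (w z : C).

Lemma rf_zeros_poles_seq h : h != 0 ->
  {t : seq C | uniq t & forall w, (w \in t) = root (rf_num h) w || root (rf_den h) w}.
Proof.
move=> h0; have n0 : rf_num h != 0.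
  by apply: contraNneq h0 => n0; rewrite [h]rf_numden n0 tofrac0 mul0r.
have roots_of (p : {poly C}) : p != 0 -> {s : seq C | forall w, (w \in s) = root p w}.
  move=> p0; have [s ps] := closed_field_poly_normal p; exists s => w.
  by rewrite ps rootZ ?lead_coef_eq0 // root_prod_XsubC.
have [s1 s1P] := roots_of _ n0.
have [s2 s2P] := roots_of _ (rf_den_neq0 h).
exists (undup (s1 ++ s2)); first exact: undup_uniq.
by move=> w; rewrite mem_undup mem_cat s1P s2P.
Qed.

Lemma rf_mult_neq0 h w : h != 0 -> root (rf_num h) w || root (rf_den h) w ->
  rf_mult h w != 0.
Proof.
move=> h0; have n0 : rf_num h != 0.
  by apply: contraNneq h0 => n0; rewrite [h]rf_numden n0 tofrac0 mul0r.
rewrite /rf_mult subr_eq0 eqz_nat => nd.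
have mup_gt0 (p : {poly C}) : p != 0 -> root p w -> (0 < mup w p)%N.
  by move=> p0; rewrite -XsubC_dvd // dvdp_XsubCl.
(* By coprimality one of the two multiplicities is 0, so their difference cannot cancel. *)
have [nw|nw] := boolP (root (rf_num h) w).
  by rewrite (mupNroot (rf_coprime_root nw)) -lt0n mup_gt0.
move: nd; rewrite (negPf nw) => dw.
by rewrite (mupNroot nw) eq_sym -lt0n mup_gt0 ?rf_den_neq0.
Qed.

End ZerosAndPoles.

Theorem corollary2 (R : realType) (z0 : R[i]) (k : int) (r : R)
    (h : {fraction {poly R[i]}}) :
  k != 0 -> 0 < r -> h != 0 ->
  ~ rf_poles h z0 -> rf_eval h z0 != 0 ->
  rf_rho h z0 <= (`|k|%:~R / ((`|k|%:~R + 1) * r))%:C ->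
  forall z : R[i], 0 < `|z - z0| < r%:C ->
    ~ critical_point ((('X - z0%:P)%:F) ^ k * h) z.
Proof.
move=> k0 r0 h0 /negP dz0 hz0 rho z /andP[zz0 zr] crit.
rewrite normr_gt0 subr_eq0 in zz0.
have nz0 : ~~ root (rf_num h) z0.
  by apply: contra hz0 => /rootP n0; rewrite /rf_eval n0 mul0r.
have [t ut tP] := rf_zeros_poles_seq h0.
have z0t : z0 \notin t by rewrite tP negb_or nz0.
have mt w : w \in t -> rf_mult h w != 0 by rewrite tP; apply: rf_mult_neq0.
have K0 : 0 < `|k|%:~R :> R[i] by rewrite ltr0z normr_gt0.
have rC0 : 0 < r%:C :> R[i] by rewrite ltcR.
(* Since [z0] is neither a zero nor a pole, removing it from the index set changes nothing and [t]
   enumerates that set. *)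
have rhoE : rf_rho h z0 = \sum_(w <- t) `|(rf_mult h w)%:~R / (z0 - w)|.
  rewrite (fsbig_seq _ _ ut) /rf_rho; congr (\sum_(w \in _) _).
  apply/seteqP; split=> w /=; rewrite tP; first by case=> /orP.
  move=> nd; split; [exact/orP | move=> wz0].
  by move: nd; rewrite wz0 (negPf nz0) (negPf dz0).
have {}rho : \sum_(w <- t) `|(rf_mult h w)%:~R / (z0 - w)|
    <= `|k|%:~R / ((`|k|%:~R + 1) * r%:C).
  by rewrite -rhoE; move: rho; rewrite fmorph_div rmorphM rmorphD rmorph1 !rmorph_int.
have zt : z \notin t.
  apply/negP => zt.
  by have := weighted_point_neq K0 rC0 z0t rho zr zt (mt z zt); rewrite eqxx.
have := zt; rewrite tP negb_or => /andP[nz dz].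
have := weighted_sum_neq0 K0 rC0 z0t rho zr zz0 erefl.
(* Criticality rewrites the 0 as the logarithmic derivative; it remains to see that both sides agree
   term by term over [t]. *)
rewrite -[X in _ != X](critical_point_XsubC_exp zz0 nz dz crit).
rewrite !(logderiv_mup ut) // => [|w dw|w nw]; try by rewrite tP ?dw ?nw ?orbT.
rewrite -sumrB => /eqP; apply; congr (_ + _); apply: eq_bigr => w _.
by rewrite /rf_mult rmorphB /= mulrBl.
Qed.
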